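(* There exists a constant $C_0>0$ such that the following holds for every kernel $k$. If $k$ has finite second moment, that is $\sum_{j\in\mathbb{N}}k(j)j^2<\infty$, and $k$ is non-increasing on $\mathbb{N}$, then the corresponding operator $\mathcal{L}$ satisfies $CD(0,d)$ with the finite number $$d=C_0\cdot\frac{|k|_1\sum_{j\in\mathbb{Z}}k(j)j^2}{k(1)^2}.$$
   Context: $\mathbb{N}=\{1,2,\dots\}$. A kernel is a function $k:\mathbb{Z}\to[0,\infty)$ with $k(0)=0$, $k(-j)=k(j)$ for all $j\in\mathbb{N}$, and $0<|k|_1:=\sum_{j\in\mathbb{Z}}k(j)<\infty$. (If $k$ is non-increasing on $\mathbb{N}$ then $k(1)>0$.) The associated operator is $\mathcal{L}u(x)=\sum_{j\in\mathbb{Z}}k(j)\big(u(x+j)-u(x)\big)$, $x\in\mathbb{Z}$, and the iterated carré du champ operator is given by $\Gamma_2(u)(x)=\frac14\sum_{j,l\in\mathbb{Z}}k(j)k(l)\big(u(x+j+l)-u(x+j)-u(x+l)+u(x)\big)^2\in[0,\infty]$. A function $u:\mathbb{Z}\to\mathbb{R}$ is admissible for $CD(0,d)$ at $x\in\mathbb{Z}$ if $\sum_{j\in\mathbb{Z}}k(j)|u(x+j)|<\infty$. For $d\in(0,\infty)$, $\mathcal{L}$ satisfies $CD(0,d)$ if $\Gamma_2(u)(x)\ge\frac1d\big(\mathcal{L}u(x)\big)^2$ for every $x\in\mathbb{Z}$ and every $u$ admissible at $x$. *)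

(* Defs.v *)
From HB Require Import structures.
From mathcomp Require Import all_boot all_order all_algebra.
From mathcomp Require Import all_classical all_reals all_analysis.

Set Implicit Arguments.
Unset Strict Implicit.
Unset Printing Implicit Defensive.

Import Order.TTheory GRing.Theory Num.Theory.

Local Open Scope classical_set_scope.
Local Open Scope ring_scope.

(* The usual sum when f is absolutely summable; otherwise it may be infinite,
   with the convention +oo - +oo = -oo. *)
Definition zsum (R : realType) (f : int -> \bar R) : \bar R :=
  (\esum_(j in [set: int]) f^\+ j - \esum_(j in [set: int]) f^\- j)%E.

Definition kernel_norm1 (R : realType) (k : int -> R) : \bar R :=
  \esum_(j in [set: int]) (k j)%:E.

Definition second_moment (R : realType) (k : int -> R) : \bar R :=
  \esum_(j in [set: int]) (k j * j%:~R ^+ 2)%:E.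

Record is_kernel (R : realType) (k : int -> R) : Prop := IsKernel {
  kernel_ge0 : forall j : int, 0 <= k j ;
  kernel_at0 : k 0 = 0 ;
  kernel_sym : forall j : int, 0 < j -> k (- j) = k j ;
  kernel_norm1_gt0 : (0 < kernel_norm1 k)%E ;
  kernel_norm1_lty : (kernel_norm1 k < +oo)%E }.

Definition finite_second_moment (R : realType) (k : int -> R) : Prop :=
  (\esum_(j in [set j : int | (0 < j)%R]) (k j * j%:~R ^+ 2)%:E < +oo)%E.

Definition nonincreasing_on_N (R : realType) (k : int -> R) : Prop :=
  forall i j : int, 0 < i -> i <= j -> k j <= k i.

Definition Lop (R : realType) (k u : int -> R) (x : int) : \bar R :=
  zsum (fun j => (k j * (u (x + j) - u x))%:E).

Definition Gamma2 (R : realType) (k u : int -> R) (x : int) : \bar R :=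
  ((4^-1)%:E * \esum_(p in [set: int * int])
     (k p.1 * k p.2 *
       (u (x + p.1 + p.2) - u (x + p.1) - u (x + p.2) + u x) ^+ 2)%:E)%E.

Definition admissible (R : realType) (k u : int -> R) (x : int) : Prop :=
  (\esum_(j in [set: int]) (k j * `|u (x + j)|)%:E < +oo)%E.

(* For admissible u the value of Lop is finite. *)
Definition CD0 (R : realType) (k : int -> R) (d : R) : Prop :=
  0 < d /\
  forall (x : int) (u : int -> R), admissible k u x ->
    ((d^-1)%:E * Lop k u x ^+ 2 <= Gamma2 k u x)%E.

(* Main.v *)
Require Import Defs.
From mathcomp Require Import all_boot all_order all_algebra.
From mathcomp Require Import ring lra zify.
From mathcomp Require Import all_classical all_reals all_analysis.

Set Implicit Arguments.
Unset Strict Implicit.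
Unset Printing Implicit Defensive.

Import Order.TTheory GRing.Theory Num.Theory numFieldNormedType.Exports.

Local Open Scope classical_set_scope.
Local Open Scope ring_scope.

(** Fix [x], write [w_n = u(x+n) + u(x-n) - 2u(x)] for [n >= 1], and let
[D(j,l) = u(x+j+l) - u(x+j) - u(x+l) + u(x)], so that
[4 Gamma2(u)(x)] is the sum of [k(j) k(l) D(j,l)^2] over all [j, l].
By symmetry of the kernel, [Lu(x)] is the sum of [k(n) w_n] over [n >= 1].

The pair [(1,-1)] in [Gamma2] controls [w_1], since [D(1,-1) = - w_1].
The other [w_n] are reached one step at a time:
[w_(n+1) = w_n + w_1 + e_n] with [e_n = D(n,1) + D(-n,-1)], hence
[w_n = n w_1 + e_1 + ... + e_(n-1)], and after exchanging the sums
  [Lu(x) = w_1 * sum_n n k(n) + sum_i e_i T_i],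
where [T_i] is the tail of [k] beyond [i]. The pairs [(i,1)] and [(-i,-1)] in
[Gamma2] bound the sum of [k(1) k(i) e_i^2]. So by the Cauchy-Schwarz inequality
everything comes down to bounding the sum of [T_i^2 / k(i)] by the second
moment. This is where monotonicity enters: in the expansion of [T_i^2] as a sum
of [k(m) k(n)] with [i < m, n], the smaller index has weight at most [k(i)], so
[T_i^2 <= 2 k(i) * sum_(n > i) (n - i) k(n)] ([sqr_tail_le]), and summing over
[i] gives at most [sum_n n^2 k(n)] ([sum_tail_weight_le]). The other term is
handled by [(sum_n n k(n))^2 <= (sum_n k(n)) (sum_n n^2 k(n))].

All this is carried out for sums truncated at [N], which are finite sums of real
numbers ([sqr_sum_recurrence_le], [sqr_partial_Lop_le]); the truncations of
[Lu(x)] converge to [Lu(x)] by [zsum_cvg]. The resulting constant is [10]. In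
the code the positive index [n] is written [n.+1], so that sequences start at
[0]. *)

(** * Finite weighted sums and tails of a monotone sequence *)

(** The Cauchy-Schwarz inequality. The form with a pointwise bound
[x_i^2 <= a_i b_i] avoids dividing by weights that may vanish, and needs no
square roots. *)
Lemma sqr_sum_le (R : realFieldType) (x a b : nat -> R) (N : nat) :
  (forall i, 0 <= a i) -> (forall i, 0 <= b i) ->
  (forall i, x i ^+ 2 <= a i * b i) ->
  (\sum_(i < N) x i) ^+ 2 <= (\sum_(i < N) a i) * (\sum_(i < N) b i).
Proof.
move=> a_ge0 b_ge0 xab; elim: N => [|N IHN]; first by rewrite !big_ord0 expr0n mulr0.
rewrite !big_ord_recr /=.
have A0 : 0 <= \sum_(i < N) a i by exact: sumr_ge0.
have B0 : 0 <= \sum_(i < N) b i by exact: sumr_ge0.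
move: (\sum_(i < N) x i) (\sum_(i < N) a i) (\sum_(i < N) b i) IHN A0 B0
  => X A B XAB A0 B0.
move: (a_ge0 N) (b_ge0 N) (xab N); move: (x N) (a N) (b N) => y c d c0 d0 ycd.
(* AM-GM: the product of [A * d] and [c * B] is at least [X ^+ 2 * y ^+ 2]. *)
have cross : (X * y *+ 2) ^+ 2 <= (A * d + c * B) ^+ 2.
  have : X ^+ 2 * y ^+ 2 <= A * B * (c * d) by apply: ler_pM; rewrite ?sqr_ge0.
  have := sqr_ge0 (A * d - c * B); nra.
have : X * y *+ 2 <= A * d + c * B.
  rewrite (le_trans (ler_norm _))// -ler_sqr ?nnegrE ?normr_ge0 ?real_normK ?num_real//.
  by rewrite addr_ge0 ?mulr_ge0.
nra.
Qed.

(** Expand the squared tail and group the terms [k m * k n] by the larger index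
[n]: there are [n - i] choices of the smaller index [m], each with [k m <= k i],
and the factor 2 accounts for the two orders. The induction on [N] adds the
terms whose larger index is [N]. Subtraction is truncated, so that only the
indices [n] beyond [i] contribute on the right. *)
Lemma sqr_tail_le (R : realFieldType) (k : nat -> R) (i N : nat) :
  (forall n, 0 <= k n) -> (forall m n, (m <= n)%N -> k n <= k m) ->
  (\sum_(n < N | (i < n)%N) k n) ^+ 2 <=
    k i * (2 * \sum_(n < N) (n - i)%:R * k n).
Proof.
move=> k_ge0 k_noninc.
have tail_le M : \sum_(n < M | (i < n)%N) k n <= (M - i.+1)%:R * k i.
  elim: M => [|M IHM]; first by rewrite big_ord0 sub0n mul0r.
  rewrite big_mkcond big_ord_recr /= -big_mkcond /=.
  case: ltnP => iM; last by rewrite addr0 (le_trans IHM)// ler_wpM2r// ler_nat; lia.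
  have -> : (M.+1 - i.+1 = (M - i.+1).+1)%N by lia.
  by rewrite mulrSr mulrDl mul1r lerD// k_noninc// ltnW.
elim: N => [|N IHN]; first by rewrite !big_ord0 expr0n !mulr0.
have step (X S c a b : R) : X ^+ 2 <= a * (2 * S) -> 0 <= b -> 0 <= a ->
    b <= a -> X <= c * a -> (X + b) ^+ 2 <= a * (2 * (S + (c + 1) * b)).
  move=> XS b0 a0 ba Xc.
  have Xb : X * b <= c * a * b by exact: ler_wpM2r.
  have bb : b * b <= a * b by exact: ler_wpM2r.
  have ab : 0 <= a * b by exact: mulr_ge0.
  lra.
rewrite big_mkcond !big_ord_recr /= -big_mkcond /=.
case: ltnP => iN; last first.
  by rewrite addr0 (_ : (N - i = 0)%N) ?mul0r ?addr0//; lia.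
have -> : (N - i = (N - i.+1).+1)%N by lia.
rewrite [X in _ <= _ * (_ * (_ + X * _))]mulrSr.
exact: step IHN (k_ge0 N) (k_ge0 i) (k_noninc i N (ltnW iN)) (tail_le N).
Qed.

Lemma sum_truncB_le (n N : nat) : (\sum_(i < N) (n - i) * 2 <= n.+1 ^ 2)%N.
Proof.
elim: N n => [|N IHN] n; first by rewrite big_ord0.
rewrite big_ord_recl subn0; case: n => [|n].
  by rewrite big1.
under eq_bigr do rewrite lift0 subSS.
by apply: leq_trans (leq_add (leqnn _) (IHN n)) _; rewrite -!mulnn; nia.
Qed.

(** After exchanging the sums, [k n] gets the coefficient
[2 (n + (n - 1) + ... + 1) = n (n + 1)], which is at most [(n + 1)^2]. *)
Lemma sum_tail_weight_le (R : realFieldType) (k : nat -> R) (N : nat) :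
  (forall n, 0 <= k n) ->
  \sum_(i < N) (2 * \sum_(n < N) (n - i)%:R * k n) <=
    \sum_(n < N) n.+1%:R ^+ 2 * k n.
Proof.
move=> k_ge0; under eq_bigr do rewrite mulr_sumr.
rewrite exchange_big /=; apply: ler_sum => n _.
under eq_bigr do rewrite mulrA.
rewrite -mulr_suml ler_wpM2r// -natrX.
under eq_bigr do rewrite -natrM mulnC.
by rewrite -natr_sum ler_nat sum_truncB_le.
Qed.

(** The one-dimensional core of the argument: a sequence whose increments differ
from the first value by [e] is a linear growth plus the accumulated [e], and
both parts are measured against the second moment of [k]. *)
Lemma sqr_sum_recurrence_le (R : realFieldType) (k w e : nat -> R) (N : nat) :
  (forall n, 0 <= k n) -> (forall m n, (m <= n)%N -> k n <= k m) ->
  (forall n, w n.+1 = w n + w 0 + e n) ->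
  (\sum_(n < N) k n * w n) ^+ 2 <=
    2 * (w 0 ^+ 2 * \sum_(n < N) k n + \sum_(n < N) k n * e n ^+ 2)
      * \sum_(n < N) n.+1%:R ^+ 2 * k n.
Proof.
move=> k_ge0 k_noninc wS.
have wE n : w n = n.+1%:R * w 0 + \sum_(i < n) e i.
  elim: n => [|n IHn]; first by rewrite big_ord0 mul1r addr0.
  rewrite wS IHn big_ord_recr /= [in RHS]mulrSr; ring.
(* Exchanging the two sums weights [e i] by the tail of [k] beyond [i]. *)
have -> : \sum_(n < N) k n * w n =
    (\sum_(n < N) n.+1%:R * k n) * w 0
      + \sum_(i < N) (\sum_(n < N | (i < n)%N) k n) * e i.
  under eq_bigr => n _.
    rewrite wE (big_ord_widen N e (ltnW (ltn_ord n))) mulrDr mulr_sumr mulrA.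
    rewrite [k n * _]mulrC.
  over.
  rewrite big_split /= mulr_suml; congr (_ + _).
  rewrite (exchange_big_dep predT) //=; apply: eq_bigr => i _.
  by rewrite mulr_suml.
have S1 : (\sum_(n < N) n.+1%:R * k n) ^+ 2 <=
    (\sum_(n < N) k n) * \sum_(n < N) n.+1%:R ^+ 2 * k n.
  apply: (@sqr_sum_le _ (fun n => n.+1%:R * k n) k
    (fun n => n.+1%:R ^+ 2 * k n)) => // n; first by rewrite mulr_ge0// exprn_ge0.
  by rewrite exprMn (expr2 (k n)) mulrCA.
have S2 : (\sum_(i < N) (\sum_(n < N | (i < n)%N) k n) * e i) ^+ 2 <=
    (\sum_(n < N) k n * e n ^+ 2) * \sum_(n < N) n.+1%:R ^+ 2 * k n.
  have E0 : 0 <= \sum_(n < N) k n * e n ^+ 2.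
    by rewrite sumr_ge0// => n _; rewrite mulr_ge0// sqr_ge0.
  apply: le_trans (ler_wpM2l E0 (sum_tail_weight_le N k_ge0)).
  apply: (@sqr_sum_le _ (fun i => (\sum_(n < N | (i < n)%N) k n) * e i)
    (fun i => k i * e i ^+ 2)
    (fun i => 2 * \sum_(n < N) (n - i)%:R * k n)) => i.
  - by rewrite mulr_ge0// sqr_ge0.
  - by rewrite mulr_ge0// sumr_ge0// => n _; rewrite mulr_ge0.
  - by rewrite exprMn [X in _ <= X]mulrAC ler_wpM2r ?sqr_ge0// sqr_tail_le.
move: S1 S2.
set A := \sum_(n < N) n.+1%:R * k n; set T := \sum_(i < N) _ * e i.
set M0 := \sum_(n < N) k n; set E := \sum_(n < N) k n * _.
set M2 := \sum_(n < N) _ * k n => S1 S2.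
have : A ^+ 2 * w 0 ^+ 2 <= M0 * M2 * w 0 ^+ 2 by rewrite ler_wpM2r// sqr_ge0.
have := sqr_ge0 (A * w 0 - T).
nra.
Qed.

(** * Summation over the integers *)

Lemma sum_inj_le_esum (R : realType) (T : choiceType) (f : T -> \bar R)
    (g : nat -> T) (N : nat) : injective g ->
  (\sum_(i < N) f (g i) <= \esum_(t in [set: T]) f t)%E.
Proof.
move=> g_inj; apply: esum_ge.
have g_uniq : uniq [seq g i | i <- iota 0 N] by rewrite map_inj_uniq// iota_uniq.
exists [set` [seq g i | i <- iota 0 N]]; first by split.
by rewrite -fsbig_seq// big_map -[N in iota 0 N]subn0 big_mkord.
Qed.

Lemma esum_int_gt0 (R : realType) (f : int -> \bar R) :
  \esum_(j in [set j : int | 0 < j]) f j = \esum_(n in [set: nat]) f n.+1%:Z.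
Proof.
have pos_inj : set_inj [set: nat] (fun n : nat => n.+1%:Z) by move=> m n _ _ [].
rewrite -(esum_image _ _ f pos_inj); congr esum.
apply/seteqP; split => [j /= j0 | j [n _ <-]] //.
by exists `|j|.-1%N => //; lia.
Qed.

Lemma esum_int_lt0 (R : realType) (f : int -> \bar R) :
  \esum_(j in [set j : int | j < 0]) f j = \esum_(n in [set: nat]) f (- n.+1%:Z).
Proof.
have neg_inj : set_inj [set: nat] (fun n : nat => - n.+1%:Z).
  by move=> m n _ _ /oppr_inj [].
rewrite -(esum_image _ _ f neg_inj); congr esum.
apply/seteqP; split => [j /= j0 | j [n _ <-]] //.
by exists `|j|.-1%N => //; lia.
Qed.

(** Pairing [j] with [- j] turns sums over the integers into sums over the
naturals, whose partial sums are the symmetric truncations used below. *)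
Lemma esum_int (R : realType) (f : int -> \bar R) :
  (forall j, (0 <= f j)%E) -> f 0 = 0%E ->
  \esum_(j in [set: int]) f j =
    \esum_(n in [set: nat]) (f (n.+1%:Z)%R + f (- n.+1%:Z)%R)%E.
Proof.
move=> f_ge0 f0; rewrite esumD// -esum_int_gt0 -esum_int_lt0.
rewrite (esumID [set j : int | 0 < j])// setTI; congr (_ + _)%E.
rewrite setTI (esumID [set 0])// (esum1 (D := _ `&` [set 0])) ?add0e; last first.
  by move=> j [_ /= ->].
congr esum; apply/seteqP; split => [j [/= /negP j0 /eqP jN0] | j /= j0]; first lia.
by split; [apply/negP | apply/eqP]; lia.
Qed.

(** The difference of two sums that defines [zsum] is finite here, so it is the
limit of the differences of the truncated sums. *)
Lemma zsum_cvg (R : realType) (f : int -> R) :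
  f 0 = 0 -> (\esum_(j in [set: int]) `|f j|%:E < +oo)%E ->
  exists2 s : R, zsum (fun j => (f j)%:E) = s%:E &
    (fun N => \sum_(n < N) (f n.+1%:Z + f (- n.+1%:Z))) @ \oo --> s.
Proof.
move=> f0 f_abs.
(* The positive and the negative part of [f] are both dominated by [`|f|]. *)
have half (h : int -> R) : (forall j, 0 <= h j <= `|f j|) ->
    exists2 s : R, \esum_(j in [set: int]) (h j)%:E = s%:E &
      (fun N => \sum_(n < N) (h n.+1%:Z + h (- n.+1%:Z))) @ \oo --> s.
  move=> hP; have h_ge0 j : 0 <= h j by have /andP[] := hP j.
  have h0 : h 0 = 0.
    by apply/eqP; rewrite eq_le h_ge0 andbT; have /andP[_] := hP 0; rewrite f0 normr0.
  pose a n := (h n.+1%:Z + h (- n.+1%:Z))%:E.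
  have hE : \esum_(j in [set: int]) (h j)%:E = \esum_(n in [set: nat]) a n.
    by rewrite esum_int ?h0// => j; rewrite lee_fin.
  have a_ge0 n : (0 <= a n)%E by rewrite lee_fin addr_ge0.
  have a_summable : summable xpredT a.
    have -> : (xpredT : nat -> Prop) = [set: nat] by apply/seteqP; split.
    rewrite /summable (eq_esum (b := a)); last by move=> n _; rewrite gee0_abs.
    apply: le_lt_trans f_abs; rewrite -hE; apply: le_esum => j _.
    by rewrite lee_fin; have /andP[] := hP j.
  have a_ge0' n : xpredT n -> (0 <= a n)%E by [].
  have := summable_cvg a_ge0' a_summable.
  have := summable_nneseries_lim a_ge0' a_summable.
  rewrite nneseries_esumT// -hE; set S := fun n : nat => _.
  move=> -> S_cvg; exists (lim (S @ \oo)) => //.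
  rewrite [X in X @ _ --> _](_ : _ = S)//.
  by apply/funext => N; rewrite /S big_mkord.
have max_bound (y : R) : 0 <= Num.max y 0 <= `|y|.
  by rewrite le_max lexx orbT ge_max normr_ge0 ler_norm.
have [p pE pcvg] := half (fun j => Num.max (f j) 0) (fun j => max_bound (f j)).
have [|q qE qcvg] := half (fun j => Num.max (- f j) 0).
  by move=> j; rewrite -(normrN (f j)).
exists (p - q).
  rewrite /zsum EFinB -pE -qE; congr (_ - _)%E; apply: eq_esum => j _.
    by rewrite funeposE EFin_max.
  by rewrite funenegE EFin_max.
rewrite [X in X @ _ --> _](_ : _ =
  (fun N => \sum_(n < N) (Num.max (f n.+1%:Z) 0 + Num.max (f (- n.+1%:Z)) 0)) \-
  (fun N => \sum_(n < N) (Num.max (- f n.+1%:Z) 0 + Num.max (- f (- n.+1%:Z)) 0))).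
  exact: cvgB.
apply/funext => N /=; rewrite -sumrB; apply: eq_bigr => n _.
have posneg (y : R) : y = Num.max y 0 - Num.max (- y) 0.
  by rewrite /Num.max oppr_lt0; case: ltrgtP => // [| |->]; lra.
by rewrite [in LHS](posneg (f n.+1%:Z)) [in LHS](posneg (f (- n.+1%:Z))); lra.
Qed.

(** Lets truncated moments be compared with the full ones; the factor 2 accounts
for the negative integers. *)
Lemma even_sum_le_esum (R : realType) (f : int -> R) (N : nat) :
  (forall j, 0 <= f j) -> f 0 = 0 -> (forall n : nat, f (- n.+1%:Z) = f n.+1%:Z) ->
  ((2 * \sum_(n < N) f n.+1%:Z)%:E <= \esum_(j in [set: int]) (f j)%:E)%E.
Proof.
move=> f_ge0 f0 f_even.
rewrite esum_int ?f0//.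
apply: le_trans (sum_inj_le_esum _ N (@inj_id nat)).
rewrite sumEFin lee_fin mulr_sumr; apply: ler_sum => n _.
by rewrite f_even; lra.
Qed.

Lemma esum_mull_lty (R : realType) (T : choiceType) (c : R) (f : T -> R) :
  0 <= c -> (forall t, 0 <= f t) ->
  (\esum_(t in [set: T]) (f t)%:E < +oo)%E ->
  (\esum_(t in [set: T]) (c * f t)%:E < +oo)%E.
Proof.
move=> c_ge0 f_ge0.
have : (0 <= \esum_(t in [set: T]) (f t)%:E)%E.
  by apply: esum_ge0 => t _; rewrite lee_fin.
case fE : (\esum_(t in _) _)%E => [s| |] // _ _.
apply: le_lt_trans (ltry (c * s)); apply: ge_ereal_sup => _ [X [finX _] <-].
have : (\sum_(t \in X) (f t)%:E <= s%:E)%E by rewrite -fE; apply: esum_ge; exists X.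
rewrite !fsbig_finite//= !sumEFin !lee_fin -mulr_sumr => fX_le.
exact: ler_wpM2l.
Qed.

(** * Kernels, their operator and the truncated estimate *)

(** [Gamma2] is a quarter of the sum of [k j * k l * second_diff u x j l ^+ 2]. *)
Definition second_diff (R : realType) (u : int -> R) (x j l : int) : R :=
  u (x + j + l) - u (x + j) - u (x + l) + u x.

Lemma kernel_even (R : realType) (k : int -> R) (n : nat) :
  is_kernel k -> k (- n.+1%:Z) = k n.+1%:Z.
Proof. by move=> k_kernel; rewrite kernel_sym. Qed.

Lemma second_moment_lty (R : realType) (k : int -> R) :
  is_kernel k -> finite_second_moment k -> (second_moment k < +oo)%E.
Proof.
move=> k_kernel; rewrite /finite_second_moment esum_int_gt0 => k_fin.
have m_ge0 j : (0 <= (k j * j%:~R ^+ 2)%:E)%E.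
  by rewrite lee_fin mulr_ge0 ?kernel_ge0 ?sqr_ge0.
rewrite /second_moment esum_int ?(kernel_at0 k_kernel) ?mul0r// esumD//.
rewrite [X in (_ + X)%E](_ : _ = \esum_(n in [set: nat]) (k n.+1%:Z * n.+1%:~R ^+ 2)%:E).
  exact: lte_add_pinfty.
by apply: eq_esum => n _; rewrite (kernel_even _ k_kernel) intrN sqrrN.
Qed.

Lemma kernel1_gt0 (R : realType) (k : int -> R) :
  is_kernel k -> nonincreasing_on_N k -> 0 < k 1.
Proof.
move=> k_kernel k_noninc.
rewrite lt_neqAle kernel_ge0// andbT; apply/negP => /eqP k10.
have := kernel_norm1_gt0 k_kernel; rewrite /kernel_norm1 esum1 ?ltxx// => j _.
have kpos (n : nat) : k n.+1%:Z = 0.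
  apply/le_anti; rewrite kernel_ge0// andbT k10; exact: k_noninc.
by case: j => [[|n]|n]; rewrite ?kernel_at0// ?NegzE ?(kernel_even _ k_kernel) kpos.
Qed.

(** Selecting distinct pairs [h i] only drops nonnegative terms of [Gamma2]. *)
Lemma sum_inj_le_Gamma2 (R : realType) (k u : int -> R) (x : int) (g : R)
    (h : nat -> int * int) (N : nat) :
  is_kernel k -> injective h -> Gamma2 k u x = g%:E ->
  \sum_(i < N) k (h i).1 * k (h i).2 * second_diff u x (h i).1 (h i).2 ^+ 2 <= 4 * g.
Proof.
move=> k_kernel h_inj; rewrite /Gamma2 => GE; rewrite -lee_fin EFinM -GE muleA -EFinM.
rewrite mulfV ?pnatr_eq0// mul1e -sumEFin.
exact: (@sum_inj_le_esum R _ (fun p : int * int =>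
  (k p.1 * k p.2 * second_diff u x p.1 p.2 ^+ 2)%:E)).
Qed.

(** The truncated estimate. The factor [k 1 ^+ 2] stays on the left because the
bounds coming from [Gamma2] have the form [k 1 ^+ 2 * w_1 ^+ 2 <= 4 g] and
[k 1 * sum_i k i * e_i ^+ 2 <= 16 g]; the missing factor [k 1] in the second one
is bounded by the truncated mass. *)
Lemma sqr_partial_Lop_le (R : realType) (k u : int -> R) (x : int) (g : R)
    (N : nat) :
  is_kernel k -> nonincreasing_on_N k ->
  Gamma2 k u x = g%:E ->
  k 1 ^+ 2 *
    (\sum_(n < N) k n.+1%:Z * (u (x + n.+1%:Z) + u (x - n.+1%:Z) - 2 * u x)) ^+ 2 <=
  40 * g * (\sum_(n < N) k n.+1%:Z) * \sum_(n < N) n.+1%:R ^+ 2 * k n.+1%:Z.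
Proof.
move=> k_kernel k_noninc; case: N => [|N] GE; first by rewrite !big_ord0 expr0n !mulr0.
pose K (n : nat) := k n.+1%:Z.
pose w (n : nat) := u (x + n.+1%:Z) + u (x - n.+1%:Z) - 2 * u x.
pose D := second_diff u x.
pose e (n : nat) := D n.+1%:Z 1 + D (- n.+1%:Z) (- 1).
have K_ge0 n : 0 <= K n by exact: kernel_ge0.
have K_noninc m n : (m <= n)%N -> K n <= K m.
  by move=> mn; apply: k_noninc => //; lia.
have wS n : w n.+1 = w n + w 0 + e n.
  rewrite /w /e /D /second_diff.
  have -> : x + n.+1%:Z + 1 = x + n.+2%:Z by lia.
  have -> : x - n.+1%:Z - 1 = x - n.+2%:Z by lia.
  lra.
have w0_le : K 0 ^+ 2 * w 0 ^+ 2 <= 4 * g.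
  have h_inj : injective (fun i : nat => (i.+1%:Z, - i.+1%:Z)) by move=> m n [].
  have D_w : D 1 (- 1) = - w 0 by rewrite /D /second_diff /w addrK; lra.
  have := sum_inj_le_Gamma2 1 k_kernel h_inj GE; rewrite big_ord1 /= (kernel_even _ k_kernel).
  by rewrite -[second_diff _ _ _ _]/(D 1 (- 1)) D_w sqrrN -expr2.
have e_le : K 0 * \sum_(n < N.+1) K n * e n ^+ 2 <= 16 * g.
  have p_inj : injective (fun i : nat => (i.+1%:Z, 1 : int)) by move=> m n [].
  have n_inj : injective (fun i : nat => (- i.+1%:Z, - 1 : int)) by move=> m n [].
  have := sum_inj_le_Gamma2 N.+1 k_kernel p_inj GE.
  have := sum_inj_le_Gamma2 N.+1 k_kernel n_inj GE.
  rewrite /= => neg_le pos_le.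
  (* [(a + b)^2 <= 2 (a^2 + b^2)] for the two second differences in [e n]. *)
  have : K 0 * \sum_(n < N.+1) K n * e n ^+ 2 <=
      2 * (\sum_(i < N.+1) k i.+1%:Z * k 1 * D i.+1%:Z 1 ^+ 2 +
           \sum_(i < N.+1) k (- i.+1%:Z) * k (- 1) * D (- i.+1%:Z) (- 1) ^+ 2).
    rewrite -big_split !mulr_sumr; apply: ler_sum => n _ /=.
    have -> : k (- 1) = K 0 by exact: (kernel_even 0 k_kernel).
    rewrite (kernel_even _ k_kernel) -/(K n) -[k 1]/(K 0) /e.
    have KK : 0 <= K n * K 0 by exact: mulr_ge0.
    have := mulr_ge0 KK (sqr_ge0 (D n.+1%:Z 1 - D (- n.+1%:Z) (- 1))).
    lra.
  move=> /le_trans; apply; rewrite -/D in neg_le pos_le *.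
  lra.
have M0_ge : K 0 <= \sum_(n < N.+1) K n.
  by rewrite big_ord_recl lerDl sumr_ge0.
have := sqr_sum_recurrence_le N.+1 K_ge0 K_noninc wS.
have : 0 <= \sum_(n < N.+1) n.+1%:R ^+ 2 * K n.
  by apply: sumr_ge0 => n _; rewrite mulr_ge0// sqr_ge0.
have g_ge0 : 0 <= g.
  have := le_trans (mulr_ge0 (sqr_ge0 (K 0)) (sqr_ge0 (w 0))) w0_le.
  by rewrite pmulr_rge0.
rewrite -/K -/w -[k 1]/(K 0).
move: (\sum_(n < N.+1) K n) (\sum_(n < N.+1) K n * e n ^+ 2)
  (\sum_(n < N.+1) n.+1%:R ^+ 2 * K n) (\sum_(n < N.+1) K n * w n)
  (K 0) (K_ge0 0) (w 0) w0_le e_le M0_ge => M0 E M2 S k1 k1_ge0 w0.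
move=> w0_le e_le M0_ge M2_ge0 S_le.
have := ler_wpM2l (sqr_ge0 k1) S_le.
move=> /le_trans; apply.
rewrite mulrA; apply: ler_wpM2r => //.
have := ler_wpM2r (le_trans k1_ge0 M0_ge) w0_le.
have := ler_wpM2l k1_ge0 e_le.
have := ler_wpM2l g_ge0 M0_ge.
lra.
Qed.

Theorem theorem4p1 (R : realType) :
  exists C0 : R, 0 < C0 /\
  forall k : int -> R,
    is_kernel k ->
    finite_second_moment k ->
    nonincreasing_on_N k ->
    exists d : R,
      (d%:E = C0%:E * (kernel_norm1 k * second_moment k * ((k 1 ^+ 2)^-1)%:E))%E
      /\ CD0 k d.
Proof.
exists 10; split => // k k_kernel k_fin k_noninc.
have k1_gt0 := kernel1_gt0 k_kernel k_noninc.
have k_ge0 := kernel_ge0 k_kernel; have k0 := kernel_at0 k_kernel.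
have k_even n := kernel_even n k_kernel.
have norm_ge N : ((2 * \sum_(n < N) k n.+1%:Z)%:E <= kernel_norm1 k)%E.
  exact: even_sum_le_esum.
have moment_ge N :
    ((2 * \sum_(n < N) n.+1%:R ^+ 2 * k n.+1%:Z)%:E <= second_moment k)%E.
  under eq_bigr do rewrite mulrC.
  apply: (even_sum_le_esum (f := fun j => k j * j%:~R ^+ 2)) => [j||n].
  - by rewrite mulr_ge0// sqr_ge0.
  - by rewrite k0 mul0r.
  - by rewrite k_even intrN sqrrN.
case: (kernel_norm1 k) (kernel_norm1_lty k_kernel) norm_ge => [P| |] // _ P_ge;
  last by have := P_ge 0%N.
case: (second_moment k) (second_moment_lty k_kernel k_fin) moment_ge
  => [Q| |] // _ Q_ge; last by have := Q_ge 0%N.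
have P_gt0 : 0 < P.
  by have := P_ge 1; rewrite lee_fin big_ord1; apply: lt_le_trans; rewrite mulr_gt0.
have Q_gt0 : 0 < Q.
  have := Q_ge 1; rewrite lee_fin big_ord1; apply: lt_le_trans.
  by rewrite !mulr_gt0 ?exprn_gt0.
exists (10 * (P * Q * (k 1 ^+ 2)^-1)); split; first by rewrite !EFinM.
have d_gt0 : 0 < 10 * (P * Q * (k 1 ^+ 2)^-1).
  by rewrite !mulr_gt0// invr_gt0 exprn_gt0.
split => // x u u_adm.
have Gamma2_ge0 : (0 <= Gamma2 k u x)%E.
  apply: mule_ge0; first by rewrite lee_fin invr_ge0.
  apply: esum_ge0 => p _.
  by rewrite lee_fin; apply: mulr_ge0; [exact: mulr_ge0 | exact: sqr_ge0].
case GE : (Gamma2 k u x) Gamma2_ge0 => [g| |] // g_ge0; last by rewrite leey.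
rewrite lee_fin in g_ge0.
have Lu_summable :
    (\esum_(j in [set: int]) `|k j * (u (x + j) - u x)|%:E < +oo)%E.
  have ux_lty := esum_mull_lty (normr_ge0 (u x)) k_ge0
    (kernel_norm1_lty k_kernel).
  apply: le_lt_trans (lte_add_pinfty u_adm ux_lty).
  rewrite -esumD => [|j _|j _]; [|by rewrite lee_fin mulr_ge0..].
  apply: le_esum => j _; rewrite lee_fin normrM ger0_norm//.
  by rewrite [`|u x| * _]mulrC -mulrDr ler_wpM2l// ler_normB.
have [|s LE s_cvg] := zsum_cvg _ Lu_summable; first by rewrite k0 mul0r.
rewrite /Lop LE -EFin_expe -EFinM lee_fin mulrC ler_pdivrMr// mulrC.
apply: (ler_cvg_to (cvgM s_cvg s_cvg) (cvg_cst _)).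
apply: nearW => N /=; rewrite -expr2.
set S := (X in X ^+ 2 <= _).
have -> : S = \sum_(n < N) k n.+1%:Z * (u (x + n.+1%:Z) + u (x - n.+1%:Z) - 2 * u x).
  by apply: eq_bigr => n _; rewrite k_even; lra.
have := sqr_partial_Lop_le N k_kernel k_noninc GE.
rewrite -ler_pdivlMl ?exprn_gt0// => /le_trans; apply.
rewrite [X in _ <= X](_ : _ = (k 1 ^+ 2)^-1 * (10 * g * (P * Q))); last by ring.
rewrite ler_pM2l ?invr_gt0 ?exprn_gt0//.
set M0 := \sum_(n < N) k _; set M2 := \sum_(n < N) _.
have M0_ge0 : 0 <= M0 by exact: sumr_ge0.
have M2_ge0 : 0 <= M2 by apply: sumr_ge0 => n _; rewrite mulr_ge0// sqr_ge0.
(* [P] and [Q] count both signs, whence [40 * M0 * M2 <= 10 * P * Q]. *)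
have : 2 * M0 * (2 * M2) <= P * Q.
  by apply: ler_pM; rewrite -?lee_fin ?P_ge ?Q_ge// lee_fin mulr_ge0.
move=> /(ler_wpM2l (mulr_ge0 (ler0n _ 10) g_ge0)); apply: le_trans.
by rewrite le_eqVlt; apply/orP; left; apply/eqP; ring.
Qed.
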